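(* Let $\Sigma$ be a fixed set of states. The functors $TS_r:\mathbf{Met}\to\mathbf{Met}$ ($r\in[0,\infty]$), equipped with the maps $\eta_X$ and $\mu_X$ given in the context, form an $\mathcal R$-graded monad on $\mathbf{Met}$, where $\mathcal R=[0,\infty]$ is the pre-ordered monoid of extended non-negative reals with the usual order and addition.
   Context: $\mathbf{Met}$ is the category of extended pseudo-metric spaces (sets $A$ with $d_A:A\times A\to[0,\infty]$ satisfying $d(a,a)=0$, symmetry and the triangle inequality) and non-expansive maps. $S$ is the global state monad on sets: $SX$ is the set of functions $\Sigma\to\Sigma\times X$; $\tilde\eta_X(x)=(\sigma\mapsto(\sigma,x))$; $\tilde\mu_X:S(SX)\to SX$ is sequencing, $\tilde\mu_X(g)(\sigma)=h(\sigma')$ where $g(\sigma)=(\sigma',h)$. For a metric space $(X,d_X)$, $TS_r(X)$ has carrier $\{(x,f)\in X\times SX\mid \text{for all }\sigma\in\Sigma,\ \text{writing } f(\sigma)=(\sigma',a),\ d_X(x,a)\le r\}$ and metric $d((x,f),(y,g))=d_X(x,y)$. A morphism $h:X\to Y$ acts by $(x,f)\mapsto(h(x),S(h)(f))$. For $q\le r$ the map $(q\le r)$ is the inclusion. $\eta_X:X\to TS_0X$ is $\eta_X(x)=(x,\tilde\eta_X(x))$, and $\mu_X=\mu_{q,r,X}:TS_q(TS_rX)\to TS_{q+r}X$ is $\mu_X((x,f),g)=(x,\tilde\mu_X(S(\pi_2)(g)))$, where $g\in S(TS_rX)$ and $\pi_2:TS_rX\to SX$ is the second projection. **Graded monad.**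 An $\mathcal R$-graded monad on a category consists of endofunctors $T_r$ ($r\in\mathcal R$), natural transformations $(q\le r):T_q\to T_r$ for $q\le r$ (functorial in the order), $\eta:\mathrm{Id}\to T_0$, and $\mu_{q,r}:T_qT_r\to T_{q+r}$ (compatible with the maps $(q\le r)$ in both indices), such that for all objects $A$: $\mu_{0,r,A}\circ\eta_{T_rA}=\mathrm{id}_{T_rA}=\mu_{r,0,A}\circ T_r\eta_A$ and $\mu_{p,q+r,A}\circ T_p\mu_{q,r,A}=\mu_{p+q,r,A}\circ\mu_{p,q,T_rA}$. *)

(* Defs.v *)
From mathcomp Require Import all_boot all_order all_algebra.
From mathcomp Require Import boolp reals constructive_ereal.

Set Implicit Arguments.
Unset Strict Implicit.
Unset Printing Implicit Defensive.

Import Order.TTheory GRing.Theory Num.Theory.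

Record category := Category {
  obj :> Type;
  mor : obj -> obj -> Type;
  idm : forall A, mor A A;
  cmp : forall A B C, mor B C -> mor A B -> mor A C;
  cmp1m : forall A B (f : mor A B), cmp (idm B) f = f;
  cmpm1 : forall A B (f : mor A B), cmp f (idm A) = f;
  cmpA : forall A B C D (h : mor C D) (g : mor B C) (f : mor A B),
    cmp h (cmp g f) = cmp (cmp h g) f }.

Arguments mor {c} A B.
Arguments idm {c} A.

Declare Scope cat_scope.
Local Open Scope cat_scope.
Notation "g \;o f" := (cmp g f) (at level 50, left associativity) : cat_scope.

Definition is_functor (C D : category) (F0 : C -> D)
    (F1 : forall A B, mor A B -> mor (F0 A) (F0 B)) : Prop :=
  (forall A, F1 A A (idm A) = idm (F0 A)) /\
  (forall A B E (g : mor B E) (f : mor A B),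
     F1 A E (g \;o f) = F1 B E g \;o F1 A B f).

Definition is_natural (C D : category) (F0 G0 : C -> D)
    (F1 : forall A B, mor A B -> mor (F0 A) (F0 B))
    (G1 : forall A B, mor A B -> mor (G0 A) (G0 B))
    (t : forall A, mor (F0 A) (G0 A)) : Prop :=
  forall A B (f : mor A B), G1 A B f \;o t A = t B \;o F1 A B f.

Record pomonoid := POMonoid {
  grade :> Type;
  gle : grade -> grade -> Prop;
  g0 : grade;
  gadd : grade -> grade -> grade;
  gle_refl : forall r, gle r r;
  gle_trans : forall p q r, gle p q -> gle q r -> gle p r;
  gle_add : forall q q' r r', gle q q' -> gle r r' ->
    gle (gadd q r) (gadd q' r');
  gaddA : forall p q r, gadd p (gadd q r) = gadd (gadd p q) r;
  gadd0l : forall r, gadd g0 r = r;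
  gadd0r : forall r, gadd r g0 = r }.

Arguments g0 {_}.

(* The monoid laws on grades hold only up to propositional equality, so the
   two sides of each graded monad law have different codomains a priori;
   [regrade] transports a morphism along such an equality. *)
Definition regrade (C : category) (M : pomonoid) (T : M -> C -> C)
    (A B : C) (q r : M) (e : q = r) (f : mor A (T q B)) : mor A (T r B) :=
  ecast s (mor A (T s B)) e f.

Section GradedMonad.
Variables (C : category) (M : pomonoid).
Variable T : M -> C -> C.
Variable Tmap : forall r (A B : C), mor A B -> mor (T r A) (T r B).
Variable Tle : forall q r, gle q r -> forall A : C, mor (T q A) (T r A).
Variable eta : forall A : C, mor A (T g0 A).
Variable mu : forall q r (A : C), mor (T q (T r A)) (T (gadd q r) A).

(* The order on grades is a thin category: the equations for [Tle] are
   required for all proofs of the inequalities involved. *)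
Record is_graded_monad : Prop := IsGradedMonad {
  gm_functor : forall r, is_functor (@Tmap r);
  gm_le_natural : forall q r (qr : gle q r),
    is_natural (@Tmap q) (@Tmap r) (Tle qr);
  gm_le_refl : forall r (rr : gle r r) A, Tle rr A = idm (T r A);
  gm_le_trans : forall p q r (pq : gle p q) (qr : gle q r) (pr : gle p r) A,
    Tle pr A = Tle qr A \;o Tle pq A;
  gm_eta_natural : is_natural (fun A B (f : mor A B) => f) (@Tmap g0) eta;
  gm_mu_natural : forall q r,
    is_natural (fun A B (f : mor A B) => Tmap q (Tmap r f))
               (@Tmap (gadd q r)) (mu q r);
  gm_mu_le : forall q q' r r' (qq' : gle q q') (rr' : gle r r')
      (s : gle (gadd q r) (gadd q' r')) A,
    mu q' r' A \;o (Tle qq' (T r' A) \;o Tmap q (Tle rr' A)) =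
    Tle s A \;o mu q r A;
  gm_unitl : forall r A,
    regrade (gadd0l r) (mu g0 r A \;o eta (T r A)) = idm (T r A);
  gm_unitr : forall r A,
    regrade (gadd0r r) (mu r g0 A \;o Tmap r (eta A)) = idm (T r A);
  gm_assoc : forall p q r A,
    regrade (gaddA p q r) (mu p (gadd q r) A \;o Tmap p (mu q r A)) =
    mu (gadd p q) r A \;o mu p q (T r A) }.

End GradedMonad.

Section ENNReal.
Variable R : realType.
Local Open Scope ereal_scope.

Definition ennreal := {r : \bar R | 0 <= r}.
Definition ennle (q r : ennreal) : Prop := sval q <= sval r.
Definition enn0 : ennreal := exist _ 0 (lexx 0).
Definition ennadd (q r : ennreal) : ennreal :=
  exist _ (sval q + sval r) (adde_ge0 (svalP q) (svalP r)).

Lemma ennle_refl r : ennle r r.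
Proof. exact: lexx. Qed.

Lemma ennle_trans p q r : ennle p q -> ennle q r -> ennle p r.
Proof. exact: le_trans. Qed.

Lemma ennle_add q q' r r' : ennle q q' -> ennle r r' ->
  ennle (ennadd q r) (ennadd q' r').
Proof. exact: leeD. Qed.

Lemma ennaddA p q r : ennadd p (ennadd q r) = ennadd (ennadd p q) r.
Proof. by apply: val_inj; rewrite /= addeA. Qed.

Lemma ennadd0l r : ennadd enn0 r = r.
Proof. by apply: val_inj; rewrite /= add0e. Qed.

Lemma ennadd0r r : ennadd r enn0 = r.
Proof. by apply: val_inj; rewrite /= adde0. Qed.

Definition ENN : pomonoid :=
  POMonoid ennle_refl ennle_trans ennle_add ennaddA ennadd0l ennadd0r.

End ENNReal.

Section Met.
Variable R : realType.
Local Open Scope ereal_scope.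

Record epmetric := EPMetric {
  points :> Type;
  dist : points -> points -> \bar R;
  dist_ge0 : forall a b, 0 <= dist a b;
  distxx : forall a, dist a a = 0;
  dist_sym : forall a b, dist a b = dist b a;
  dist_triangle : forall a b c, dist a c <= dist a b + dist b c }.

Record nonexp (A B : epmetric) := NonExp {
  nefun :> A -> B;
  nefunP : forall a b, dist (nefun a) (nefun b) <= dist a b }.

Lemma nonexp_eq A B (f g : nonexp A B) : (forall a, f a = g a) -> f = g.
Proof.
case: f g => [f fP] [g gP] /= /funext fg; case: g / fg gP => gP.
by congr NonExp; exact: Prop_irrelevance.
Qed.

Definition ne_id A : nonexp A A := @NonExp A A id (fun a b => lexx _).

Definition ne_comp A B C (g : nonexp B C) (f : nonexp A B) : nonexp A C :=
  @NonExp A C (fun a => g (f a))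
    (fun a b => le_trans (nefunP g (f a) (f b)) (nefunP f a b)).

Lemma ne_comp1m A B (f : nonexp A B) : ne_comp (ne_id B) f = f.
Proof. exact: nonexp_eq. Qed.

Lemma ne_compm1 A B (f : nonexp A B) : ne_comp f (ne_id A) = f.
Proof. exact: nonexp_eq. Qed.

Lemma ne_compA A B C D (h : nonexp C D) (g : nonexp B C) (f : nonexp A B) :
  ne_comp h (ne_comp g f) = ne_comp (ne_comp h g) f.
Proof. exact: nonexp_eq. Qed.

Definition Met : category := Category ne_comp1m ne_compm1 ne_compA.

End Met.

Section State.
Variable Sigma : Type.

Definition St (X : Type) : Type := Sigma -> Sigma * X.

Definition St_map X Y (h : X -> Y) (f : St X) : St Y :=
  fun s => ((f s).1, h (f s).2).

Definition St_eta X (x : X) : St X := fun s => (s, x).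

Definition St_mu X (g : St (St X)) : St X := fun s => (g s).2 (g s).1.

End State.

Arguments St_eta Sigma {X} x.

Section TS.
Variables (R : realType) (Sigma : Type).
Local Open Scope ereal_scope.

Definition TS_carrier (r : ENN R) (X : Met R) : Type :=
  {u : X * St Sigma X | forall s, dist u.1 (u.2 s).2 <= sval r}.

Definition TS (r : ENN R) (X : Met R) : Met R :=
  @EPMetric R (TS_carrier r X)
    (fun u v => dist (sval u).1 (sval v).1)
    (fun u v => dist_ge0 _ _)
    (fun u => distxx _)
    (fun u v => dist_sym _ _)
    (fun u v w => dist_triangle _ _ _).

Definition TS_pair (r : ENN R) (X : Met R) (u : TS r X) : X * St Sigma X :=
  sval u.

End TS.

(* Main.v *)
Require Import Defs.
From mathcomp Require Import all_boot all_order all_algebra.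
From mathcomp Require Import boolp reals constructive_ereal.

Set Implicit Arguments.
Unset Strict Implicit.
Unset Printing Implicit Defensive.

Import Order.TTheory.

Section TSGradedMonad.
Variables (R : realType) (Sigma : Type).
Local Open Scope ereal_scope.

(** Points of [TS Sigma r X] and morphisms of [Met] are plain data subject to a proposition, so by
    [TS_mor_eq] each law is an equation of functions into [X * St Sigma X]. On points of [X] the
    unit, multiplication and inclusions act as identities, hence are non-expansive, the metric
    seeing only that component. On the second component the laws are those of the state monad.
    Grades matter only for landing in the right carrier, where the triangle inequality yields
    [gadd q r] for [TS_mu]. *)

Lemma TS_pair_inj (r : ENN R) (X : Met R) : injective (@TS_pair R Sigma r X).
Proof.
move=> [u uP] [v vP] /= uv; rewrite /TS_pair /= in uv.
by case: v / uv vP => vP; congr exist; exact: Prop_irrelevance.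
Qed.

Lemma TS_mor_eq (r : ENN R) (A X : Met R) (f g : mor A (TS Sigma r X)) :
  (forall a : points A, TS_pair (nefun f a) = TS_pair (nefun g a)) -> f = g.
Proof. by move=> fg; apply: nonexp_eq => a; exact/TS_pair_inj/fg. Qed.

(** The type [X * St Sigma X] does not mention the grade, so transport along an equality of grades
    leaves the underlying pair alone. This removes [regrade] from the unit and associativity
    laws. *)
Lemma TS_pair_regrade (q r : ENN R) (e : q = r) (A X : Met R)
    (f : mor A (TS Sigma q X)) (a : points A) :
  TS_pair (nefun (regrade (T := @TS R Sigma) e f) a) = TS_pair (nefun f a).
Proof. by case: r / e. Qed.

Lemma TS_map_subproof (r : ENN R) (X Y : Met R) (h : mor X Y)
    (u : TS Sigma r X) (s : Sigma) :
  dist (nefun h (TS_pair u).1) (St_map (nefun h) (TS_pair u).2 s).2 <= sval r.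
Proof. exact: le_trans (nefunP h _ _) (svalP u s). Qed.

Definition TS_map (r : ENN R) (X Y : Met R) (h : mor X Y) :
    mor (TS Sigma r X) (TS Sigma r Y) :=
  @NonExp R (TS Sigma r X) (TS Sigma r Y)
    (fun u => exist _ (_, _) (TS_map_subproof h u))
    (fun u v => nefunP h _ _).

Lemma TS_le_subproof (q r : ENN R) (qr : gle q r) (X : Met R)
    (u : TS Sigma q X) (s : Sigma) :
  dist (TS_pair u).1 ((TS_pair u).2 s).2 <= sval r.
Proof. exact: le_trans (svalP u s) qr. Qed.

Definition TS_le (q r : ENN R) (qr : gle q r) (X : Met R) :
    mor (TS Sigma q X) (TS Sigma r X) :=
  @NonExp R (TS Sigma q X) (TS Sigma r X)
    (fun u => exist _ (TS_pair u) (TS_le_subproof qr u))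
    (fun u v => lexx _).

Lemma TS_eta_subproof (X : Met R) (x : points X) (s : Sigma) :
  dist x (St_eta Sigma x s).2 <= sval (@g0 (ENN R)).
Proof. by rewrite distxx. Qed.

Definition TS_eta (X : Met R) : mor X (TS Sigma g0 X) :=
  @NonExp R X (TS Sigma g0 X)
    (fun x => exist _ (_, _) (TS_eta_subproof x))
    (fun x y => lexx _).

(* Running [w = ((x, f), g)] from [s] moves [x] first to the point component of
   [(g s).2], at distance at most [q], and from there by at most [r]. *)
Lemma TS_mu_subproof (q r : ENN R) (X : Met R)
    (w : TS Sigma q (TS Sigma r X)) (s : Sigma) :
  dist (TS_pair (TS_pair w).1).1
    (St_mu (St_map (fun v : TS Sigma r X => (TS_pair v).2) (TS_pair w).2) s).2
  <= sval (gadd q r).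
Proof.
apply: le_trans (dist_triangle _ (TS_pair ((TS_pair w).2 s).2).1 _) _.
by apply: leeD; [exact: (svalP w s) | exact: (svalP ((TS_pair w).2 s).2)].
Qed.

Definition TS_mu (q r : ENN R) (X : Met R) :
    mor (TS Sigma q (TS Sigma r X)) (TS Sigma (gadd q r) X) :=
  @NonExp R (TS Sigma q (TS Sigma r X)) (TS Sigma (gadd q r) X)
    (fun w => exist _ (_, _) (TS_mu_subproof w))
    (fun w w' => lexx _).

Lemma St_map_id (X : Type) (f : St Sigma X) : St_map id f = f.
Proof. by apply: funext => s; rewrite /St_map -surjective_pairing. Qed.

Lemma TS_graded_monad : is_graded_monad TS_map TS_le TS_eta TS_mu.
Proof.
split.
- move=> r; split=> [X|X Y Z g f]; apply: TS_mor_eq => u //=.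
  by rewrite /TS_pair /= St_map_id -surjective_pairing.
- by move=> q r qr X Y f; exact: TS_mor_eq.
- by move=> r rr X; exact: TS_mor_eq.
- by move=> p q r pq qr pr X; exact: TS_mor_eq.
- by move=> X Y f; exact: TS_mor_eq.
- by move=> q r X Y f; exact: TS_mor_eq.
- by move=> q q' r r' qq' rr' s X; exact: TS_mor_eq.
- move=> r X; apply: TS_mor_eq => u; rewrite TS_pair_regrade.
  by rewrite [RHS]surjective_pairing.
- move=> r X; apply: TS_mor_eq => u; rewrite TS_pair_regrade.
  (* Running the state, then the unit, gives [((f s).1, (f s).2)] at [s], which is [St_map id f] by
     computation but equals [f] only through extensionality. *)
  rewrite [RHS]surjective_pairing -[X in (_, X) = _]/(St_map id _).
  by rewrite St_map_id.
(* Both sides compute to the same three-stage run, outermost layer first. *)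
- by move=> p q r X; apply: TS_mor_eq => w; rewrite TS_pair_regrade.
Qed.

End TSGradedMonad.

(* Morphisms of Met are determined by their underlying functions, so the
   first four conditions pin down the existentially quantified maps. *)
Theorem theorem7p7 (R : realType) (Sigma : Type) :
  exists (Tmap : forall (r : ENN R) (X Y : Met R),
            mor X Y -> mor (TS Sigma r X) (TS Sigma r Y))
         (Tle : forall q r : ENN R, gle q r ->
            forall X : Met R, mor (TS Sigma q X) (TS Sigma r X))
         (eta : forall X : Met R, mor X (TS Sigma g0 X))
         (mu : forall (q r : ENN R) (X : Met R),
            mor (TS Sigma q (TS Sigma r X)) (TS Sigma (gadd q r) X)),
    (forall r X Y (h : nonexp X Y) (u : TS Sigma r X),
       TS_pair (nefun (Tmap r X Y h) u) =
       (h (TS_pair u).1, St_map h (TS_pair u).2)) /\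
    (forall q r (qr : gle q r) X (u : TS Sigma q X),
       TS_pair (nefun (Tle q r qr X) u) = TS_pair u) /\
    (forall (X : Met R) (x : points X),
       TS_pair (nefun (eta X) x) = (x, St_eta Sigma x)) /\
    (forall q r X (w : TS Sigma q (TS Sigma r X)),
       TS_pair (nefun (mu q r X) w) =
       ((TS_pair (TS_pair w).1).1,
        St_mu (St_map (fun v : TS Sigma r X => (TS_pair v).2)
                      (TS_pair w).2))) /\
    is_graded_monad Tmap Tle eta mu.
Proof.
exists (@TS_map R Sigma), (@TS_le R Sigma), (@TS_eta R Sigma), (@TS_mu R Sigma).
by do 4!split=> //; exact: TS_graded_monad.
Qed.
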